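(* The following statements are equivalent for every graph $G$: (i) $G$ is paw-pivot-minor-free. (ii) $G$ is diamond-pivot-minor-free. (iii) $G$ has no induced subgraph isomorphic to the paw, the diamond, or an odd cycle of length at least $5$. (iv) Every connected component of $G$ is either bipartite or complete.
   Context: Graphs are finite, without loops or multiple edges. The paw is the graph obtained from a triangle by adding one vertex adjacent to exactly one vertex of the triangle; the diamond is $K_4$ minus one edge. For a vertex $u$ of a graph $G$, the local complementation $G*u$ is obtained from $G$ by complementing the adjacency between every pair of distinct neighbours of $u$. For an edge $uv$ of $G$, the edge pivot is $G\wedge uv=((G*u)*v)*u$. A graph $G$ contains $H$ as a pivot-minor if $H$ can be obtained from $G$ by a sequence of vertex deletions and edge pivots; $G$ is $H$-pivot-minor-free if it contains no pivot-minor isomorphic to $H$. *)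

(* Defs.v *)
From mathcomp Require Import all_boot.

Set Implicit Arguments.
Unset Strict Implicit.
Unset Printing Implicit Defensive.

Record sgraph := SGraph {
  vertex :> finType;
  adj : rel vertex;
  adj_sym : symmetric adj;
  adj_irr : irreflexive adj
}.

Definition isomorphic (G H : sgraph) : Prop :=
  exists2 f : G -> H, bijective f & forall x y, adj (f x) (f y) = adj x y.

Section SymGraph.
Variables (T : finType) (r : rel T).

(* The simple graph obtained from r by forgetting orientations and loops. *)
Definition sym_rel : rel T := fun x y => (x != y) && (r x y || r y x).

Fact sym_rel_sym : symmetric sym_rel.
Proof. by move=> x y; rewrite /sym_rel eq_sym orbC. Qed.

Fact sym_rel_irr : irreflexive sym_rel.
Proof. by move=> x; rewrite /sym_rel eqxx. Qed.

Definition sym_graph : sgraph := SGraph sym_rel_sym sym_rel_irr.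
End SymGraph.

(* Triangle 0, 1, 2 and a vertex 3 adjacent to 0 only. *)
Definition paw : sgraph :=
  sym_graph (fun i j : 'I_4 =>
    (nat_of_ord i, nat_of_ord j) \in [:: (0, 1); (0, 2); (1, 2); (0, 3)]).

(* K_4 minus the edge between 2 and 3. *)
Definition diamond : sgraph :=
  sym_graph (fun i j : 'I_4 =>
    (nat_of_ord i, nat_of_ord j) \in [:: (0, 1); (0, 2); (0, 3); (1, 2); (1, 3)]).

(* The cycle of length n when n >= 3. *)
Definition cycle_graph (n : nat) : sgraph :=
  sym_graph (fun i j : 'I_n => j == i.+1 %% n :> nat).

Section Induced.
Variables (G : sgraph) (S : {set G}).

Definition induced_rel : rel {x : G | x \in S} := fun x y => adj (val x) (val y).

Fact induced_rel_sym : symmetric induced_rel.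
Proof. by move=> x y; apply: adj_sym. Qed.

Fact induced_rel_irr : irreflexive induced_rel.
Proof. by move=> x; apply: adj_irr. Qed.

Definition induced : sgraph := SGraph induced_rel_sym induced_rel_irr.
End Induced.

Definition has_induced (G H : sgraph) : Prop :=
  exists S : {set G}, isomorphic (induced S) H.

Definition delete_vertex (G : sgraph) (v : G) : sgraph := induced [set~ v].

Section LocalComplement.
Variables (G : sgraph) (u : G).

Definition local_rel : rel G :=
  fun x y => if [&& x != y, adj u x & adj u y] then ~~ adj x y else adj x y.

Fact local_rel_sym : symmetric local_rel.
Proof.
by move=> x y; rewrite /local_rel eq_sym [adj u x && _]andbC (adj_sym x y).
Qed.

Fact local_rel_irr : irreflexive local_rel.
Proof. by move=> x; rewrite /local_rel eqxx adj_irr. Qed.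

Definition local_complement : sgraph := SGraph local_rel_sym local_rel_irr.
End LocalComplement.

Definition pivot (G : sgraph) (u v : G) : sgraph :=
  @local_complement (@local_complement (@local_complement G u) v) u.

Inductive pivot_reachable (G : sgraph) : sgraph -> Prop :=
| pivot_reachable_refl : pivot_reachable G G
| pivot_reachable_delete (H : sgraph) (v : H) :
    pivot_reachable G H -> pivot_reachable G (delete_vertex v)
| pivot_reachable_pivot (H : sgraph) (u v : H) :
    pivot_reachable G H -> adj u v -> pivot_reachable G (pivot u v).

Definition pivot_minor (G H : sgraph) : Prop :=
  exists2 H' : sgraph, pivot_reachable G H' & isomorphic H' H.

Definition pivot_minor_free (H G : sgraph) : Prop := ~ pivot_minor G H.

Definition components (G : sgraph) : {set {set G}} :=
  equivalence_partition (connect (@adj G)) [set: G].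

Definition bipartite (G : sgraph) : Prop :=
  exists c : G -> bool, forall x y, adj x y -> c x != c y.

Definition complete (G : sgraph) : Prop := forall x y : G, x != y -> adj x y.

(* Main.v *)
(* Pivoting the paw on an edge between its centre and a vertex of degree 2 gives
   the diamond, and conversely; pivoting an edge of C_n and deleting its ends
   gives C_(n-2), while C_5 pivots to a graph containing the paw.  So excluding
   either pivot-minor excludes the induced subgraphs of (iii).  Under (iii), the
   neighbours of a vertex lying in a triangle form a clique, so a component with
   a triangle is complete; a component without one has no induced odd cycle,
   hence no odd closed walk, and is bipartite.  Finally (iv) is preserved by
   pivots and deletions, and fails for the paw. *)
Require Import Defs.
From mathcomp Require Import all_boot.
From mathcomp Require Import zify.

Set Implicit Arguments.
Unset Strict Implicit.
Unset Printing Implicit Defensive.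

(** * Embeddings and pivot-minors *)

Definition embedding (H G : sgraph) (f : H -> G) : Prop :=
  injective f /\ forall x y, adj (f x) (f y) = adj x y.

Definition embeds (H G : sgraph) : Prop := exists f : H -> G, embedding f.

Lemma embeds_trans (K H G : sgraph) : embeds K H -> embeds H G -> embeds K G.
Proof.
move=> [f [f_inj fE]] [g [g_inj gE]]; exists (g \o f).
by split=> [|x y]; [apply: inj_comp | rewrite /= gE fE].
Qed.

Lemma embeds_induced (G : sgraph) (S : {set G}) : embeds (induced S) G.
Proof. by exists val; split=> //; apply: val_inj. Qed.

Lemma isomorphic_embeds (G H : sgraph) : isomorphic G H -> embeds H G.
Proof.
move=> [f [g fK gK] fE]; exists g; split; first exact: can_inj gK.
by move=> x y; rewrite -fE !gK.
Qed.

Lemma has_inducedP (G H : sgraph) : has_induced G H <-> embeds H G.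
Proof.
split=> [[S /isomorphic_embeds isoH]|[f [f_inj fE]]].
  exact: embeds_trans isoH (embeds_induced S).
have fP x : f x \in [set f z | z in H] by apply: imset_f.
have gP (y : induced [set f z | z in H]) : exists x, f x == val y.
  by have /imsetP[x _ ->] := valP y; exists x.
pose g y := xchoose (gP y).
have gK y : f (g y) = val y by apply/eqP/(xchooseP (gP y)).
exists [set f z | z in H], g.
  exists (fun x => Sub (f x) (fP x)) => [y|x].
    by apply: val_inj; rewrite SubK gK.
  by apply: f_inj; rewrite gK SubK.
by move=> x y; rewrite -fE !gK.
Qed.

Lemma embeds_delete (H G : sgraph) (f : H -> G) (v : G) :
  embedding f -> (forall x, f x != v) -> embeds H (delete_vertex v).
Proof.
move=> [f_inj fE] fv.
have fP x : f x \in [set~ v] by rewrite !inE.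
exists (fun x => Sub (f x) (fP x)); split=> [x y /(congr1 val)|x y].
  by rewrite !SubK => /f_inj.
by rewrite /= /induced_rel !SubK fE.
Qed.

(** Induction on the order of [H']: a vertex outside the image of [H] can be deleted, and once there
    is none the embedding is an isomorphism. *)
Lemma pivot_reachable_embeds (G H' H : sgraph) :
  pivot_reachable G H' -> embeds H H' -> pivot_minor G H.
Proof.
have [n] := ubnP #|H'|; elim: n H' => // n IHn H' ltn GH' [f fP].
have [/existsP[v /forallP fv]|/existsPn f_surj] :=
    boolP [exists v, forall x, f x != v].
  apply: (IHn (delete_vertex v)).
  - rewrite card_sig (eq_card (B := mem [set~ v])) // cardsC1.
    by have := max_card (pred1 v); rewrite card1; lia.
  - exact: pivot_reachable_delete.
  - exact: embeds_delete fP fv.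
have [f_inj fE] := fP.
have gP y : exists x, f x == y by have /forallPn[x /negPn] := f_surj y; exists x.
pose g y := xchoose (gP y).
have gK y : f (g y) = y by apply/eqP/(xchooseP (gP y)).
exists H' => //; exists g; last by move=> x y; rewrite -fE !gK.
by exists f => // x; apply: f_inj.
Qed.

Lemma pivot_minor_embeds (G H K : sgraph) :
  pivot_minor G H -> embeds K H -> pivot_minor G K.
Proof.
move=> [H' GH' /isomorphic_embeds HH'] KH.
exact: pivot_reachable_embeds GH' (embeds_trans KH HH').
Qed.

Lemma has_induced_pivot_minor (G H : sgraph) :
  has_induced G H -> pivot_minor G H.
Proof.
by move=> /has_inducedP; apply/pivot_reachable_embeds/pivot_reachable_refl.
Qed.

Lemma embedding_local (H G : sgraph) (f : H -> G) (u : H) :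
  embedding f ->
  @embedding (local_complement u) (local_complement (f u)) f.
Proof.
move=> [f_inj fE]; split=> // x y.
by rewrite /= /local_rel !fE (inj_eq f_inj).
Qed.

(** Local complementation commutes with embeddings, so the pivot of [H] is mirrored in [H'] by the
    pivot on the images of [u] and [v]. *)
Lemma pivot_minor_pivot (G H : sgraph) (u v : H) :
  pivot_minor G H -> adj u v -> pivot_minor G (pivot u v).
Proof.
move=> [H' GH' /isomorphic_embeds[f fP]] uv.
have fuv : adj (f u) (f v) by rewrite fP.2.
apply: pivot_reachable_embeds (pivot_reachable_pivot GH' fuv) _.
by exists f; do 3!apply: embedding_local.
Qed.

(** * Adjacency in a pivot *)

Lemma local_adjE (G : sgraph) (u x y : G) :
  @adj (local_complement u) x y = adj x y (+) [&& x != y, adj u x & adj u y].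
Proof. by rewrite /= /local_rel; case: ifP; rewrite ?addbT ?addbF. Qed.

Section PivotAdj.
Variables (G : sgraph) (u v : G).
Hypothesis uv : adj u v.

Let u_neq_v : u != v. Proof. by apply: contraTneq uv => ->; rewrite adj_irr. Qed.
Let vu : adj v u. Proof. by rewrite adj_sym. Qed.

(** The toggling term is a 2 by 2 determinant over the field with two elements: it is true exactly
    when [x] and [y] have distinct nonzero patterns of adjacency to [u] and [v]. *)
Lemma pivot_adj (x y : G) : x != u -> x != v -> y != u -> y != v ->
  @adj (pivot u v) x y =
  adj x y (+) ((x != y) && ((adj u x && adj v y) (+) (adj v x && adj u y))).
Proof.
move=> xu xv yu yv; have [<-|xy] := eqVneq x y; first by rewrite !adj_irr.
rewrite !local_adjE !adj_irr vu uv xy ![u == _]eq_sym ![v == _]eq_sym.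
rewrite (negPf xu) (negPf xv) (negPf yu) (negPf yv) (negPf u_neq_v) /=.
by case: (adj u x); case: (adj v x); case: (adj u y); case: (adj v y);
  case: (adj x y).
Qed.

Lemma pivot_adjl (y : G) : y != u -> y != v -> @adj (pivot u v) u y = adj v y.
Proof.
move=> yu yv; rewrite !local_adjE !adj_irr vu uv eqxx ![u == _]eq_sym ![v == _]eq_sym.
rewrite (negPf yu) (negPf yv) (negPf u_neq_v) /=.
by case: (adj u y); case: (adj v y).
Qed.

Lemma pivot_adjr (y : G) : y != u -> y != v -> @adj (pivot u v) v y = adj u y.
Proof.
move=> yu yv; rewrite !local_adjE !adj_irr vu uv eqxx ![u == _]eq_sym ![v == _]eq_sym.
rewrite (negPf yu) (negPf yv) (negPf u_neq_v) /=.
by case: (adj u y); case: (adj v y).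
Qed.

Lemma pivot_adj_edge : @adj (pivot u v) u v.
Proof. by rewrite !local_adjE !adj_irr vu uv !eqxx ?[v == u]eq_sym u_neq_v. Qed.
End PivotAdj.

(** * Pivots between the paw, the diamond and odd cycles *)

(** The pivot on 02 exchanges the outer neighbourhoods of 0 and 2 and removes the edge 13. This
    leaves a paw centred at 2, hence the table that swaps 0 and 2. *)
Lemma pivot_minor_diamond_paw (G : sgraph) :
  pivot_minor G diamond -> pivot_minor G paw.
Proof.
pose u : diamond := @Ordinal 4 0 isT; pose v : diamond := @Ordinal 4 2 isT.
have uv : adj u v by [].
move=> /pivot_minor_pivot/(_ uv) /pivot_minor_embeds; apply.
have swK (i : nat) : i < 4 -> nth 0 [:: 2; 1; 0; 3] i < 4 by case: i => [|[|[|[|]]]].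
exists (fun i : paw => Ordinal (swK _ (ltn_ord i))).
split.
  move=> [[|[|[|[|]]]] //= ?] [[|[|[|[|]]]] //= ?] /(congr1 val) //= _;
    exact: val_inj.
by move=> [[|[|[|[|]]]] // ?] [[|[|[|[|]]]] // ?]; vm_compute.
Qed.

(** Here the pivot on 02 creates the edge 13, and 0 and 3 become the nonadjacent pair of a
    diamond. *)
Lemma pivot_minor_paw_diamond (G : sgraph) :
  pivot_minor G paw -> pivot_minor G diamond.
Proof.
pose u : paw := @Ordinal 4 0 isT; pose v : paw := @Ordinal 4 2 isT.
have uv : adj u v by [].
move=> /pivot_minor_pivot/(_ uv) /pivot_minor_embeds; apply.
have swK (i : nat) : i < 4 -> nth 0 [:: 2; 1; 0; 3] i < 4 by case: i => [|[|[|[|]]]].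
exists (fun i : diamond => Ordinal (swK _ (ltn_ord i))).
split.
  move=> [[|[|[|[|]]]] //= ?] [[|[|[|[|]]]] //= ?] /(congr1 val) //= _;
    exact: val_inj.
by move=> [[|[|[|[|]]]] // ?] [[|[|[|[|]]]] // ?]; vm_compute.
Qed.

Lemma succ_mod (i n : nat) : i < n -> i.+1 %% n = if i.+1 == n then 0 else i.+1.
Proof.
move=> lt_in; case: eqP => [->|]; first by rewrite modnn.
by move=> ?; rewrite modn_small //; lia.
Qed.

Lemma cycle_adjE (n : nat) (i j : cycle_graph n) :
  adj i j = (i != j :> nat) &&
    [|| j == i.+1 :> nat, i == j.+1 :> nat,
        (i.+1 == n) && (j == 0 :> nat) | (j.+1 == n) && (i == 0 :> nat)].
Proof.
rewrite /= /sym_rel -val_eqE /= !succ_mod //.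
by have := ltn_ord i; have := ltn_ord j; do 2!case: ifP; lia.
Qed.

(** The pivot on 34 adds the chord 02 and makes 3 adjacent to 0 instead of 2, so the vertices other
    than 4 form the paw with its own labels. *)
Lemma pivot_minor_cycle5_paw (G : sgraph) :
  pivot_minor G (cycle_graph 5) -> pivot_minor G paw.
Proof.
pose u : cycle_graph 5 := @Ordinal 5 3 isT; pose v : cycle_graph 5 := @Ordinal 5 4 isT.
have uv : adj u v by [].
move=> /pivot_minor_pivot/(_ uv) /pivot_minor_embeds; apply.
exists (fun i : paw => widen_ord (isT : 4 <= 5) i); split.
  by move=> i j /(congr1 val) /= /val_inj.
by move=> [[|[|[|[|]]]] // ?] [[|[|[|[|]]]] // ?]; vm_compute.
Qed.

(* Pivoting on the last edge of the cycle joins its other two neighbours. *)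
Lemma pivot_minor_cycle_shrink (G : sgraph) (n : nat) : 2 < n ->
  pivot_minor G (cycle_graph n.+2) -> pivot_minor G (cycle_graph n).
Proof.
move=> n_gt2; pose u : cycle_graph n.+2 := inord n.
pose v : cycle_graph n.+2 := inord n.+1.
have uE : u = n :> nat by rewrite inordK.
have vE : v = n.+1 :> nat by rewrite inordK.
have uv : adj u v by rewrite cycle_adjE uE vE; lia.
move=> /pivot_minor_pivot/(_ uv) /pivot_minor_embeds; apply.
have le_n : n <= n.+2 by lia.
exists (fun i : cycle_graph n => widen_ord le_n i); split.
  by move=> i j /(congr1 val) /= /val_inj.
move=> i j; have lt_in := ltn_ord i; have lt_jn := ltn_ord j.
have uE' (k : cycle_graph n.+2) : k < n -> adj u k = (k.+1 == n).
  by rewrite cycle_adjE uE => ?; lia.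
have vE' (k : cycle_graph n.+2) : k < n -> adj v k = (k == 0 :> nat).
  by rewrite cycle_adjE vE => ?; lia.
set x := widen_ord _ i; set y := widen_ord _ j.
have xE : x = i :> nat by []. have yE : y = j :> nat by [].
have [xu xv yu yv] : [/\ x != u, x != v, y != u & y != v].
  by rewrite -!val_eqE [val x]xE [val y]yE [val u]uE [val v]vE; split; lia.
have xy : (x == y) = (i == j :> nat) by rewrite -val_eqE.
rewrite (pivot_adj uv xu xv yu yv) xy !uE' ?vE' ?xE ?yE //.
(* Below [n] the long cycle induces only a path; the edge between [0] and [n.-1] has to come from
   the pivot term. *)
have -> : @adj (cycle_graph n.+2) x y = (j == i.+1 :> nat) || (i == j.+1 :> nat).
  by rewrite cycle_adjE xE yE; lia.
rewrite cycle_adjE; have [ij|ij|->] := ltngtP i j; last by lia.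
  have -> : (i == j.+1 :> nat) = false by lia.
  have -> : (j == 0 :> nat) = false by lia.
  by clear -lt_in lt_jn n_gt2 ij; lia.
have -> : (j == i.+1 :> nat) = false by lia.
have -> : (i == 0 :> nat) = false by lia.
by clear -lt_in lt_jn n_gt2 ij; lia.
Qed.

Lemma pivot_minor_odd_cycle_paw (G : sgraph) (n : nat) : 5 <= n -> odd n ->
  pivot_minor G (cycle_graph n) -> pivot_minor G paw.
Proof.
have [m] := ubnP n; elim: m n => // m IHm n ltn n_ge5 n_odd.
have [->|n_neq5] := eqVneq n 5; first exact: pivot_minor_cycle5_paw.
case: n => [|[|n]] // in ltn n_ge5 n_odd n_neq5 *.
rewrite /= negbK in n_odd.
(* Length 5 being settled, the shortened length is not 3; being odd, it is not 4 either, so it is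
   again at least 5. *)
have n_neq4 : n != 4 by apply: contraTneq n_odd => ->.
by move/pivot_minor_cycle_shrink => Gn; apply: (IHm n) => //; [| |apply: Gn]; lia.
Qed.

(** * Odd closed walks and 2-colourings *)

(** Only the values at [0], ..., [n] matter; with a total function, walks are cut and reglued by
    shifting indices. *)
Definition closed_walk (G : sgraph) (n : nat) (w : nat -> G) : Prop :=
  (forall i, i < n -> adj (w i) (w i.+1)) /\ w n = w 0.

(** A repeated vertex cuts the walk into this arc and the one of [closed_walk_outer]. Their lengths
    add up to [n], so if [n] is odd, one of them is odd. *)
Lemma closed_walk_inner (G : sgraph) (n i j : nat) (w : nat -> G) :
  closed_walk n w -> i < j <= n -> w i = w j ->
  closed_walk (j - i) (fun k => w (i + k)).
Proof.
move=> [wP _] /andP[ij jn] wij; split=> [k kd|]; last by rewrite subnKC ?addn0 // ltnW.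
by rewrite addnS; apply: wP; lia.
Qed.

Lemma closed_walk_outer (G : sgraph) (n i j : nat) (w : nat -> G) :
  closed_walk n w -> i < j < n -> w i = w j ->
  closed_walk (n - (j - i)) (fun k => if k <= i then w k else w (k + (j - i))).
Proof.
move=> [wP wn] /andP[ij jn] wij; split=> [k kd|]; last first.
  by rewrite leq0n -wn ifN; [congr w|]; lia.
case: (ltngtP k i) => [ki|ki|->].
- by apply: wP; lia.
- by rewrite addSn; apply: wP; lia.
- by rewrite wij (_ : _ + _ = j.+1); [apply: wP|]; lia.
Qed.

(** A chord closes up both arcs at the cost of one step each. The two lengths add up to [n.+2], so
    again an odd [n] makes one of them odd. *)
Lemma closed_walk_inner_chord (G : sgraph) (n i j : nat) (w : nat -> G) :
  closed_walk n w -> i < j <= n -> adj (w i) (w j) ->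
  closed_walk (j - i).+1 (fun k => if k <= j - i then w (i + k) else w i).
Proof.
move=> [wP _] /andP[ij jn] wij; split=> [k kd|]; last by rewrite ltnn addn0.
rewrite -ltnS kd; case: ltnP => [kd'|dk]; first by rewrite addnS; apply: wP; lia.
by rewrite (_ : i + k = j) ?(adj_sym (w j)) //; lia.
Qed.

Lemma closed_walk_outer_chord (G : sgraph) (n i j : nat) (w : nat -> G) :
  closed_walk n w -> i < j < n -> adj (w i) (w j) ->
  closed_walk (n - (j - i)).+1
    (fun k => if k <= i then w k else w (k + (j - i).-1)).
Proof.
move=> [wP wn] /andP[ij jn] wij; split=> [k kd|]; last first.
  by rewrite leq0n -wn ifN; [congr w|]; lia.
case: (ltngtP k i) => [ki|ki|->].
- by apply: wP; lia.
- by rewrite addSn; apply: wP; lia.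
- by rewrite (_ : _ + _ = j) //; lia.
Qed.

(* In a shortest odd closed walk, a repeated vertex or a chord would split off
   a shorter odd closed walk, so the walk is an induced cycle. *)
Lemma odd_closed_walk_induced_cycle (G : sgraph) (n : nat) (w : nat -> G) :
  odd n -> closed_walk n w ->
  exists m, [/\ 3 <= m, odd m & embeds (cycle_graph m) G].
Proof.
have [m] := ubnP n; elim: m n w => // m IHm n w ltn n_odd wW.
have [wP wn] := wW.
have n_neq1 : n != 1.
  apply/eqP => n1; rewrite n1 in wP wn.
  by have := wP 0 isT; rewrite wn adj_irr.
(* The pair is a repetition or a chord; the bounds on [j - i] for a chord are exactly what makes
   both pieces shorter than [n]. *)
have [/existsP[i /existsP[j /and3P[ij]]]|short] := boolP [exists i : 'I_n,
  exists j : 'I_n, [&& i < j, (w i == w j) || adj (w i) (w j) &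
    (w i == w j) || (i.+1 < j) && (j - i < n.-1)]].
  have jn := ltn_ord j; have ijn : i < j < n by rewrite ij.
  have ijn' : i < j <= n by rewrite ij ltnW.
  have [wij _ _|_ /= wij /andP[ij1 jin]] := eqVneq (w i) (w j).
    have [d_odd|d_even] := boolP (odd (j - i)).
      by apply: IHm (closed_walk_inner wW ijn' wij); lia.
    by apply: IHm (closed_walk_outer wW ijn wij); lia.
  have [d_odd|d_even] := boolP (odd (j - i)).
    by apply: IHm (closed_walk_outer_chord wW ijn wij); lia.
  by apply: IHm (closed_walk_inner_chord wW ijn' wij); lia.
have shortF (i j : 'I_n) : i < j ->
    (w i != w j) && (adj (w i) (w j) ==> (j == i.+1 :> nat) || (n.-1 <= j - i)).
  move=> ij; move: short => /existsPn/(_ i)/existsPn/(_ j).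
  rewrite ij /=; case: eqVneq => //= _; case: (adj _ _) => //=; lia.
exists n; split=> //; first by lia.
exists (fun i : cycle_graph n => w i).
have adjP (i j : 'I_n) : i < j -> adj (w i) (w j) = @adj (cycle_graph n) i j.
  move=> ij; have jn := ltn_ord j; have /andP[_ /implyP wij] := shortF i j ij.
  rewrite cycle_adjE; apply/idP/idP => [/wij|]; first by lia.
  case/andP=> _ /or4P[/eqP->|/eqP ?|/andP[/eqP ? /eqP ?]|/andP[/eqP jE /eqP ->]].
  - by apply: wP; lia.
  - lia.
  - lia.
  - by rewrite adj_sym; have := wP _ jn; rewrite jE wn.
split=> [i j wij|i j]; first apply: val_inj.
  by case: (ltngtP i j) => // /shortF; rewrite wij eqxx.
case: (ltngtP i j) => [/adjP //|/adjP ji|/val_inj->]; last by rewrite !adj_irr.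
by rewrite adj_sym ji adj_sym.
Qed.

(** The tensor product of [G] with $K_2$: the second coordinate records the parity of a walk, so odd
    closed walks through [x] join [(x, b)] to [(x, ~~ b)]. *)
Definition double_cover (G : sgraph) : rel (G * bool) :=
  fun x y => adj x.1 y.1 && (x.2 != y.2).

Lemma double_cover_sym (G : sgraph) : symmetric (@double_cover G).
Proof. by move=> x y; rewrite /double_cover adj_sym eq_sym. Qed.

Lemma path_double_cover_parity (G : sgraph) (x : G * bool) (p : seq (G * bool)) :
  path (@double_cover G) x p -> (last x p).2 = x.2 (+) odd (size p).
Proof.
elim: p x => [|y p IHp] x /=; first by rewrite addbF.
case/andP=> /andP[_ xy] /IHp->.
by case: (x.2) xy; case: (y.2); case: (odd _).
Qed.

Lemma double_cover_closed_walk (G : sgraph) (x : G) (b : bool) :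
  connect (@double_cover G) (x, b) (x, ~~ b) ->
  exists n w, odd n /\ @closed_walk G n w.
Proof.
move=> /connectP[p pP pE]; pose s := (x, b) :: p.
exists (size p), (fun k => (nth (x, b) s k).1); split.
  have := path_double_cover_parity pP; rewrite -pE /=.
  by case: b {pP pE s}; case: (odd _).
split=> [i ip|]; first by have /andP[] := pathP (x, b) pP i ip.
by rewrite (nth_last _ s) /= -pE.
Qed.

Lemma no_odd_cycle_bipartite (G : sgraph) :
  (forall n, 3 <= n -> odd n -> ~ embeds (cycle_graph n) G) -> bipartite G.
Proof.
move=> no_cycle; pose e := @double_cover G.
have eC : connect_sym e by apply/sym_connect_sym/double_cover_sym.
have eF x b : ~ connect e (x, b) (x, ~~ b).
  move=> /double_cover_closed_walk[n [w [n_odd wW]]].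
  by have [m [? ? /no_cycle]] := odd_closed_walk_induced_cycle n_odd wW; apply.
have step x y z b : adj x y -> connect e z (x, b) -> connect e z (y, ~~ b).
  move=> xy /connect_trans; apply; apply: connect1.
  by rewrite /e /double_cover xy; case: b.
have adjC : connect_sym (@adj G) by apply/sym_connect_sym/adj_sym.
pose r := root (@adj G).
(* The colour of [x] tells whether an odd walk leads to it from the root of its component. *)
exists (fun x => connect e (r x, false) (x, true)) => x y xy.
have -> : r y = r x by apply/esym/eqP; rewrite root_connect ?connect1.
have [cx|/negP cx] := boolP (connect e _ (x, true)).
  apply/negP => /eqP/esym cy; have := step _ _ _ _ xy cx => /=.
  by rewrite eC => /connect_trans/(_ cy)/eF.
apply/negP => /eqP/esym/negP[].
(* Every vertex of the component is reached with some parity. As [x] is not reached by an odd walk,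
   it is reached by an even one, and then [y] by an odd one. *)
have lift z : connect (@adj G) (r x) z -> exists b, connect e (r x, false) (z, b).
  move=> /connectP[p pP ->]; elim/last_ind: p pP => [|p a IHp] /=.
    by exists false.
  rewrite rcons_path last_rcons => /andP[/IHp[b cb] ab].
  by exists (~~ b); apply: step ab cb.
have [|[] //] := lift x; first by rewrite adjC connect_root.
exact: step xy.
Qed.

(** * Triangles without induced paw or diamond *)

(** Otherwise the four vertices induce a diamond with nonadjacent pair [y], [t] if [t] is adjacent
    to [z], and a paw with [t] pendant at [x] if not. *)
Lemma triangle_neighbourhood (G : sgraph) (x y z t : G) :
  ~ embeds paw G -> ~ embeds diamond G ->
  adj x y -> adj x z -> adj y z -> adj x t -> t != y -> adj t y.
Proof.
move=> no_paw no_diamond xy xz yz xt ty.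
have [->|tz] := eqVneq t z; first by rewrite adj_sym.
have neq (a b : G) : adj a b -> (a == b = false) * (b == a = false).
  move=> ab; rewrite (eq_sym b).
  by split; apply: contraTF ab => /eqP->; rewrite adj_irr.
have adjs : (adj x y = true) * (adj x z = true) * (adj y z = true) * (adj x t = true)
  * (adj y x = true) * (adj z x = true) * (adj z y = true) * (adj t x = true).
  by rewrite !(adj_sym _ x) (adj_sym z) xy xz yz xt.
have diffs := (neq _ _ xy, neq _ _ xz, neq _ _ yz, neq _ _ xt,
  negPf ty, negPf tz, eq_sym y t, eq_sym z t).
have emb (H : sgraph) (f : H -> G) : injective f ->
  (forall i j, adj (f i) (f j) = adj i j) -> embeds H G by exists f.
apply: contraT => nty; have nyt : ~~ adj y t by rewrite adj_sym.
have [tz'|ntz] := boolP (adj t z).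
  have zt : adj z t by rewrite adj_sym.
  case: no_diamond.
  apply: (emb _ (fun i : diamond => nth x [:: x; z; y; t] i)).
    move=> [[|[|[|[|]]]] //= ?] [[|[|[|[|]]]] //= ?] /eqP;
    rewrite ?diffs // => _; exact: val_inj.
  by move=> [[|[|[|[|]]]] //= ?] [[|[|[|[|]]]] //= ?];
    rewrite /sym_rel -!val_eqE /= ?(adj_irr, adjs, negPf nty, negPf nyt, tz', zt).
have nzt : ~~ adj z t by rewrite adj_sym.
case: no_paw.
apply: (emb _ (fun i : paw => nth x [:: x; y; z; t] i)).
  move=> [[|[|[|[|]]]] //= ?] [[|[|[|[|]]]] //= ?] /eqP;
  rewrite ?diffs // => _; exact: val_inj.
by move=> [[|[|[|[|]]]] //= ?] [[|[|[|[|]]]] //= ?];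
  rewrite /sym_rel -!val_eqE /=
    ?(adj_irr, adjs, negPf nty, negPf nyt, negPf ntz, negPf nzt).
Qed.


Definition in_triangle (G : sgraph) (x : G) : Prop :=
  exists y z, [/\ adj x y, adj x z & adj y z].

Section NoPawDiamond.
Variable G : sgraph.
Hypotheses (no_paw : ~ embeds paw G) (no_diamond : ~ embeds diamond G).

(** Let [x], [p], [q] be the triangle. A neighbour [y] other than [p] is adjacent to [p], so [x],
    [y], [p] is a triangle too, and [triangle_neighbourhood] for it gives the edge to [z]. *)
Lemma in_triangle_clique (x y z : G) :
  in_triangle x -> adj x y -> adj x z -> y != z -> adj y z.
Proof.
move=> [p [q [xp xq pq]]] xy xz yz; have nbr := triangle_neighbourhood no_paw no_diamond.
have [yp|yp] := eqVneq y p.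
  by rewrite yp adj_sym; apply: nbr xp xq pq xz _; rewrite -yp eq_sym.
rewrite adj_sym; apply: (nbr _ _ _ _ xy xp _ xz); last by rewrite eq_sym.
exact: nbr xp xq pq xy yp.
Qed.

Lemma in_triangle_adj (x y : G) : in_triangle x -> adj x y -> in_triangle y.
Proof.
move=> xT xy; have [p [q [xp xq pq]]] := xT; have yx : adj y x by rewrite adj_sym.
have [->|yp] := eqVneq y p; first by exists x, q; rewrite adj_sym.
by exists x, p; split=> //; apply: in_triangle_clique xT _ _ _.
Qed.

(** Induction along a path: its last vertex so far lies in a triangle, so [x] and the next vertex,
    both in its neighbourhood, are adjacent or equal. *)
Lemma in_triangle_connect (x y : G) : in_triangle x -> connect (@adj G) x y ->
  in_triangle y /\ (x != y -> adj x y).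
Proof.
move=> xT /connectP[p pP ->]; elim/last_ind: p pP => [|p z IHp] /=.
  by rewrite eqxx.
rewrite rcons_path last_rcons => /andP[/IHp[yT xy] yz].
split=> [|xz]; first exact: in_triangle_adj yT yz.
have [xl|xl] := eqVneq x (last x p); first by rewrite xl.
by apply: in_triangle_clique yT _ yz xz; rewrite adj_sym xy.
Qed.
End NoPawDiamond.

Lemma in_triangle_cycle3 (G : sgraph) (f : cycle_graph 3 -> G) (i : cycle_graph 3) :
  embedding f -> in_triangle (f i).
Proof.
move=> [_ fE]; exists (f (ordS i)), (f (ordS (ordS i))); rewrite !fE.
by case: i => [[|[|[|]]] //= ?].
Qed.

Lemma component_bipartite_complete (G : sgraph) (C : {set G}) :
  ~ has_induced G paw -> ~ has_induced G diamond ->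
  (forall n, 5 <= n -> odd n -> ~ has_induced G (cycle_graph n)) ->
  C \in components G -> bipartite (induced C) \/ complete (induced C).
Proof.
rewrite !has_inducedP => no_paw no_diamond no_cycle /imsetP[x _ CE].
have adjC : connect_sym (@adj G) by apply/sym_connect_sym/adj_sym.
have conn y z : y \in C -> z \in C -> connect (@adj G) y z.
  by rewrite CE !inE /= adjC; apply: connect_trans.
have [/existsP[t /existsP[y /existsP[z /and4P[tC ty tz yz]]]]|noT] :=
    boolP [exists t, exists y, exists z, [&& t \in C, adj t y, adj t z & adj y z]].
  right=> a b ab; have tT : in_triangle t by exists y, z.
  have [aT _] := in_triangle_connect no_paw no_diamond tT (conn _ _ tC (valP a)).
  exact: (in_triangle_connect no_paw no_diamond aT (conn _ _ (valP a) (valP b))).2.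
left; apply: no_odd_cycle_bipartite => n n_ge3 n_odd nC.
(* Length 3 is not covered by [no_cycle]; it is excluded because no triangle meets [C]. *)
have [n3|n_neq3] := eqVneq n 3.
  rewrite n3 in nC; have [f fP] := nC.
  have [y [z [ty tz yz]]] := in_triangle_cycle3 ord0 fP.
  case/negP: noT; apply/existsP; exists (val (f ord0)).
  apply/existsP; exists (val y).
  by apply/existsP; exists (val z); apply/and4P; split=> //; apply: valP.
have n_neq4 : n != 4 by apply: contraTneq n_odd => ->.
apply: (no_cycle n) => //; first by lia.
by apply/has_inducedP; apply: embeds_trans nC (embeds_induced C).
Qed.

(** * Invariance of condition (iv) under pivots and deletions *)

(* [K] marks the vertices in complete components and [c] properly colours the
   remaining ones, so this restates (iv) without mentioning components. *)
Definition bipartite_or_cluster (G : sgraph) : Prop :=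
  exists K c : G -> bool,
    [/\ forall x y, adj x y -> K x = K y,
        forall x y, adj x y -> ~~ K x -> c x != c y &
        forall x y z, K x -> adj x y -> adj x z -> y != z -> adj y z].

Lemma bipartite_or_cluster_embeds (H G : sgraph) :
  embeds H G -> bipartite_or_cluster G -> bipartite_or_cluster H.
Proof.
move=> [f [f_inj fE]] [K [c [K1 K2 K3]]]; exists (K \o f), (c \o f).
split=> [x y|x y|x y z Kx]; rewrite -!fE; [exact: K1|exact: K2|].
by rewrite -(inj_eq f_inj); apply: K3.
Qed.

(** If the centre 0 is marked, its neighbours 1 and 3 would be adjacent; if not, the triangle 012
    would be properly 2-coloured. *)
Lemma paw_not_bipartite_or_cluster : ~ bipartite_or_cluster paw.
Proof.
move=> [K [c [K1 K2 K3]]].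
pose v i (lti : i < 4) : paw := Ordinal lti.
pose v0 := v 0 isT; pose v1 := v 1 isT; pose v2 := v 2 isT; pose v3 := v 3 isT.
have [K0|nK0] := boolP (K v0).
  by have := K3 v0 v1 v3 K0 isT isT isT.
have := K2 v0 v1 isT nK0; have := K2 v0 v2 isT nK0.
have nK1 : ~~ K v1 by rewrite -(K1 v0 v1 isT).
by have := K2 v1 v2 isT nK1; case: (c v0); case: (c v1); case: (c v2).
Qed.

(** Case analysis on the edges of a pivot. An edge avoiding [u] and [v] is either old or joins a
    neighbour of [u] to one of [v]; symmetry of [P] leaves one orientation to check. *)
Lemma pivot_adj_ind (G : sgraph) (u v : G) (P : G -> G -> Prop) :
  adj u v -> (forall x y, P x y -> P y x) -> P u v ->
  (forall y, y != u -> y != v -> adj v y -> P u y) ->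
  (forall y, y != u -> y != v -> adj u y -> P v y) ->
  (forall x y, x != u -> x != v -> y != u -> y != v ->
     adj x y || (adj u x && adj v y) -> P x y) ->
  forall x y : G, @adj (pivot u v) x y -> P x y.
Proof.
move=> uv P_sym Puv Pu Pv Pxy x y.
have [->|xu] := eqVneq x u.
  have [->|yu] := eqVneq y u; first by rewrite adj_irr.
  have [->//|yv] := eqVneq y v.
  by rewrite pivot_adjl //; apply: Pu.
have [->|xv] := eqVneq x v.
  have [->|yu] := eqVneq y u; first by move=> _; apply: P_sym.
  have [->|yv] := eqVneq y v; first by rewrite adj_irr.
  by rewrite pivot_adjr //; apply: Pv.
have [->|yu] := eqVneq y u.
  by rewrite adj_sym pivot_adjl // => ?; apply/P_sym/Pu.
have [->|yv] := eqVneq y v.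
  by rewrite adj_sym pivot_adjr // => ?; apply/P_sym/Pv.
rewrite pivot_adj // => xy.
have [xy1|] := boolP (adj x y || (adj u x && adj v y)); first exact: Pxy.
rewrite negb_or => /andP[/negPf nxy /negPf nuv]; apply/P_sym/Pxy => //.
by move: xy; rewrite nxy nuv /= => /andP[_ /andP[-> ->]]; rewrite orbT.
Qed.

(* An edge in a complete component joins twins, so pivoting on it changes
   nothing; pivoting on an edge [uv] elsewhere swaps the colours of [u] and
   [v]. *)
Lemma bipartite_or_cluster_pivot (G : sgraph) (u v : G) :
  adj u v -> bipartite_or_cluster G -> bipartite_or_cluster (pivot u v).
Proof.
move=> uv [K [c [K1 K2 K3]]]; have vu : adj v u by rewrite adj_sym.
have Kuv := K1 _ _ uv.
have [Ku|nKu] := boolP (K u).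
  have twin x : x != u -> x != v -> adj u x = adj v x.
    move=> xu xv; apply/idP/idP => [ux|vx].
      by apply: K3 Ku uv ux _; rewrite eq_sym.
    by apply: K3 vu vx _; rewrite -?Kuv // eq_sym.
  have sameu (y : G) : @adj (pivot u v) u y = adj u y.
    have [->|yu] := eqVneq y u; first by rewrite !adj_irr.
    have [->|yv] := eqVneq y v; first by rewrite uv pivot_adj_edge.
    by rewrite pivot_adjl // twin.
  have samev (y : G) : @adj (pivot u v) v y = adj v y.
    have [->|yu] := eqVneq y u; first by rewrite adj_sym sameu adj_sym.
    have [->|yv] := eqVneq y v; first by rewrite !adj_irr.
    by rewrite pivot_adjr // twin.
  have same (x y : G) : @adj (pivot u v) x y = adj x y.
    have [->|xu] := eqVneq x u; first exact: sameu.
    have [->|xv] := eqVneq x v; first exact: samev.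
    have [->|yu] := eqVneq y u; first by rewrite adj_sym sameu adj_sym.
    have [->|yv] := eqVneq y v; first by rewrite adj_sym samev adj_sym.
    by rewrite pivot_adj // !twin // addbb andbF addbF.
  by exists K, c; split=> [x y|x y|x y z]; rewrite !same;
    [exact: K1 | exact: K2 | exact: K3].
have nKv : ~~ K v by rewrite -Kuv.
have pK (x y : G) : @adj (pivot u v) x y -> K x = K y.
  apply: (pivot_adj_ind (P := fun x y => K x = K y)) => //.
  - by move=> {x}y _ _ /K1 <-.
  - by move=> {x}y _ _ /K1 <-.
  - by move=> {}x {}y _ _ _ _ /orP[/K1 //|/andP[/K1 <- /K1 <-]].
(* Marked vertices lie outside the component of [uv], so the pivot does not affect adjacency between
   them. *)
have notuv x : K x -> (x != u) * (x != v) * ~~ adj u x * ~~ adj v x.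
  move=> Kx; split; [split; [split|]|]; apply: contraTN Kx.
  - by move/eqP->.
  - by move/eqP->.
  - by move/K1 <-.
  - by move/K1 <-.
have same (x y : G) : K x -> K y -> @adj (pivot u v) x y = adj x y.
  move=> Kx Ky; rewrite pivot_adj ?notuv //.
  by rewrite (negPf (notuv _ Kx).1.2) (negPf (notuv _ Kx).2) andbF addbF.
pose c' x := if (x == u) || (x == v) then ~~ c x else c x.
have cuv := K2 _ _ uv nKu.
have c'E x : x != u -> x != v -> c' x = c x by rewrite /c' => /negPf-> /negPf->.
have c'u : c' u = c v by rewrite /c' eqxx; case: (c u) cuv; case: (c v).
have c'v : c' v = c u by rewrite /c' eqxx orbT; case: (c u) cuv; case: (c v).
have pc (x y : G) : @adj (pivot u v) x y -> ~~ K x -> ~~ K y -> c' x != c' y.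
  apply: (pivot_adj_ind (P := fun x y => ~~ K x -> ~~ K y -> c' x != c' y)) => //.
  - by move=> {}x {}y cxy nKy nKx; rewrite eq_sym cxy.
  - by rewrite c'u c'v eq_sym cuv.
  - by move=> {}y yu yv vy _ _; rewrite c'u c'E //; apply: K2.
  - by move=> {}y yu yv uy _ _; rewrite c'v c'E //; apply: K2.
  - move=> {}x {}y xu xv yu yv xy nKx nKy; rewrite !c'E //.
    (* A new edge joins a neighbour of [u], coloured like [v], to a neighbour of [v], coloured like
       [u]. *)
    case/orP: xy => [xy|/andP[ux vy]]; first exact: K2.
    have := K2 _ _ ux nKu; have := K2 _ _ vy nKv.
    by case: (c x); case: (c y); move: cuv; case: (c u); case: (c v).
exists K, c'; split=> // [x y xy nKx|x y z Kx xy xz yz].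
  by apply: (pc _ _ xy nKx); rewrite -(pK _ _ xy).
have Ky : K y by rewrite -(pK _ _ xy).
have Kz : K z by rewrite -(pK _ _ xz).
by rewrite same //; apply: (K3 x) => //; rewrite -same.
Qed.

Lemma bipartite_or_cluster_reachable (G H : sgraph) :
  pivot_reachable G H -> bipartite_or_cluster G -> bipartite_or_cluster H.
Proof.
move=> GH GQ; elim: GH => // [{}H v _|{}H u v _ HQ uv].
  exact/bipartite_or_cluster_embeds/embeds_induced.
exact: bipartite_or_cluster_pivot.
Qed.

(** Completeness and the colouring are both read off the set [C x], so adjacent vertices get the
    same mark and use the same colouring. *)
Lemma components_bipartite_or_cluster (G : sgraph) :
  (forall C : {set G}, C \in components G ->
     bipartite (induced C) \/ complete (induced C)) ->
  bipartite_or_cluster G.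
Proof.
move=> Gcomp; pose C x := [set y in [set: G] | connect (@adj G) x y].
have CP x : C x \in components G by apply: imset_f.
have adjC : connect_sym (@adj G) by apply/sym_connect_sym/adj_sym.
have CE x y : adj x y -> C x = C y.
  by move=> xy; apply/setP => z; rewrite !inE (same_connect adjC (connect1 xy)).
have Cx x : x \in C x by rewrite !inE connect0.
have Cy x y : adj x y -> y \in C x by move=> xy; rewrite !inE connect1.
pose K (D : {set G}) := [forall y in D, forall z in D, (y != z) ==> adj y z].
pose col (D : {set G}) (f : {ffun G -> bool}) :=
  [forall y in D, forall z in D, adj y z ==> (f y != f z)].
(* The constant default arises only when [D] has no proper 2-colouring; a component without one is
   complete, hence marked by [K]. *)
pose c (D : {set G}) := odflt [ffun=> false] [pick f | col D f].
exists (fun x => K (C x)), (fun x => c (C x) x); split=> [x y /CE->//|x y xy nK|].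
  rewrite -(CE x y xy) /c; case: pickP => [f|no_col] /=.
    by move=> /forall_inP/(_ x (Cx x))/forall_inP/(_ y (Cy x y xy))/implyP; apply.
  case: (Gcomp _ (CP x)) => [[f fP]|Ccomplete]; last first.
    case/negP: nK; apply/forall_inP => a aC; apply/forall_inP => b bC.
    apply/implyP => ab; exact: (Ccomplete (Sub a aC) (Sub b bC)).
  (* The colouring [f] of the induced subgraph is extended by [false] outside the component. *)
  have /negP[] := negbT (no_col [ffun z => if insub z is Some a then f a else false]).
  apply/forall_inP => a aC; apply/forall_inP => b bC; apply/implyP => ab.
  by rewrite !ffunE !insubT; apply: fP.
move=> x y z Kx xy xz yz.
by have /forall_inP/(_ y (Cy x y xy))/forall_inP/(_ z (Cy x z xz))/implyP := Kx; apply.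
Qed.

Theorem proposition5p4 (G : sgraph) :
  [<-> pivot_minor_free paw G;
       pivot_minor_free diamond G;
       [/\ ~ has_induced G paw,
           ~ has_induced G diamond &
           forall n : nat, 5 <= n -> odd n -> ~ has_induced G (cycle_graph n)];
       forall C : {set G}, C \in components G ->
         bipartite (induced C) \/ complete (induced C)].
Proof.
tfae.
- by move=> no_paw /pivot_minor_diamond_paw.
- move=> no_diamond; split=> [||n n_ge5 n_odd] /has_induced_pivot_minor //.
    by move/pivot_minor_paw_diamond.
  by move/(pivot_minor_odd_cycle_paw n_ge5 n_odd)/pivot_minor_paw_diamond.
- by move=> [no_paw no_diamond no_cycle] C; apply: component_bipartite_complete.
- move=> /components_bipartite_or_cluster GQ [H GH /isomorphic_embeds HP].
  apply: paw_not_bipartite_or_cluster; apply: bipartite_or_cluster_embeds HP _.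
  exact: bipartite_or_cluster_reachable GH GQ.
Qed.
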